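(* Let $p$ be a prime, let $\varphi_1,\varphi_2:\mathbb{F}_p\to\mathbb{F}_p$ be arbitrary functions, and let $K_\Gamma$, $I_\Gamma$, $\mathcal{A}_\Gamma$ be as defined in the context. Suppose that there are constants $C_1,C_2,C_3,M>0$ and exponents $\theta\in(0,1]$, $\alpha\in(\tfrac14,1)$, $\beta>1$ such that: (1) for every $s\in\mathbb{F}_p\setminus\{0\}$, $\left|\frac1p\sum_{y\in\mathbb{F}_p}e_p(s\varphi_1(y))\right|\le C_1p^{-\theta}$; (2) for all $x,y\in\mathbb{F}_p$, $|K_\Gamma(x,y)|\le C_2p^{-\alpha}$; (3) for every $h\in\mathbb{F}_p\setminus\{0\}$ there is a set $D_h\subset\mathbb{F}_p\times\mathbb{F}_p$ such that for every $y\in\mathbb{F}_p$ there are at most $M$ elements $y'$ with $(y,y')\in D_h$, and for every $y'\in\mathbb{F}_p$ there are at most $M$ elements $y$ with $(y,y')\in D_h$, and such that $|I_\Gamma(h,y,y')|\le C_3p^{-\beta}$ for all $(y,y')\notin D_h$. Then, with $\gamma=\min\{\theta,\ \alpha-\tfrac14,\ \tfrac{\beta}{4}-\tfrac14\}$, there is a constant $C$ depending only on $C_1,C_2,C_3,M$ (and not on $p$, $\varphi_1,\varphi_2$ otherwise, or the functions below) such that for all $f_1,f_2:\mathbb{F}_p\to\mathbb{C}$, $$\|\mathcal{A}_\Gamma(f_1,f_2)-\mathbb{E}[f_1]\mathbb{E}[f_2]\|_2\le C\,p^{-\gamma}\|f_1\|_2\|f_2\|_2.$$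
   Context: $e_p(x)=e^{2\pi i x/p}$ for $x\in\mathbb{F}_p$. For $f:\mathbb{F}_p\to\mathbb{C}$: $\mathbb{E}[f]=\frac1p\sum_{x\in\mathbb{F}_p}f(x)$ and $\|f\|_2=\left(\frac1p\sum_{x}|f(x)|^2\right)^{1/2}$ (normalized norm). The bilinear average along $\Gamma=(\varphi_1,\varphi_2)$ is $\mathcal{A}_\Gamma(f_1,f_2)(x)=\frac1p\sum_{y\in\mathbb{F}_p}f_1(x+\varphi_1(y))f_2(x+\varphi_2(y))$. The kernel is $K_\Gamma(x,y)=\frac1p\sum_{z\in\mathbb{F}_p}e_p(x\varphi_1(z)+y\varphi_2(z))$ if $y\neq0$ and $K_\Gamma(x,0)=0$. For $h,y,y'\in\mathbb{F}_p$, $I_\Gamma(h,y,y')=\sum_{x\in\mathbb{F}_p}K_\Gamma(x,y)\overline{K_\Gamma(x-h,y+h)}\,\overline{K_\Gamma(x,y')}K_\Gamma(x-h,y'+h)$. *)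

(* Defs.v *)
From mathcomp Require Import all_boot all_order all_algebra.
From mathcomp Require Import complex.
From mathcomp Require Import reals exp trigo.

Set Implicit Arguments.
Unset Strict Implicit.
Unset Printing Implicit Defensive.

Import GRing.Theory Num.Theory.
Local Open Scope ring_scope.
Local Open Scope complex_scope.

(* Moduli are taken with [Normc.normc : R[i] -> R], since [`|z|] lives in R[i].
   All definitions make sense for any [p : nat], but 'F_p has exactly p elements
   only when p is prime. *)

Section BilinearAverages.
Variables (R : realType) (p : nat).
Implicit Types (f : 'F_p -> R[i]) (phi : 'F_p -> 'F_p).

(* [x%:R] uses the representative of x in {0, ..., p - 1}. *)
Definition e_p (x : 'F_p) : R[i] :=
  let t := pi *+ 2 * (x : nat)%:R / p%:R in cos t +i* sin t.

Definition expect f : R[i] := p%:R^-1 * \sum_(x : 'F_p) f x.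

Definition norm2 f : R :=
  Num.sqrt (p%:R^-1 * \sum_(x : 'F_p) Normc.normc (f x) ^+ 2).

Definition bilinear_avg phi1 phi2 f1 f2 (x : 'F_p) : R[i] :=
  p%:R^-1 * \sum_(y : 'F_p) f1 (x + phi1 y) * f2 (x + phi2 y).

Definition kernelK phi1 phi2 (x y : 'F_p) : R[i] :=
  if y == 0 then 0
  else p%:R^-1 * \sum_(z : 'F_p) e_p (x * phi1 z + y * phi2 z).

Definition corrI phi1 phi2 (h y y' : 'F_p) : R[i] :=
  let K := kernelK phi1 phi2 in
  \sum_(x : 'F_p) K x y * (K (x - h) (y + h))^*
                  * (K x y')^* * K (x - h) (y' + h).

End BilinearAverages.

Arguments e_p {R p} x.
Arguments kernelK {R p} phi1 phi2 x y.
Arguments corrI {R p} phi1 phi2 h y y'.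

(* Main.v *)
(** Expanding [f1] and [f2] in characters, the Fourier coefficients of the
    bilinear average are [sum_(k + l = n) a(k) b(l) m(k, l)], where
    [m(k, l) = E_z e_p (k phi1(z) + l phi2(z))].  The term [k = l = 0] is
    [E f1 * E f2].  The terms with [l = 0], [k <> 0] are controlled by the decay of
    [E_z e_p (k phi1(z))].  In the remaining terms [m = K], and the square of the
    l^2 norm over [n] expands, with [h] the difference of the two values of [k], into
    [sum_h sum_(x, y) A_h(x) B_h(y) K(x, y) (K(x - h, y + h))^*], where
    [A_h(x) = a(x) (a(x - h))^*] and [B_h(y) = b(y) (b(y + h))^*].  The term [h = 0]
    is bounded trivially.  For [h <> 0], Cauchy-Schwarz in [x] produces the
    correlations [I(h, y, y')], which are small off the sparse set [D_h] and trivially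
    bounded on it; a last Cauchy-Schwarz in [h] uses [sum_h |A_h|_2^2 = |a|_2^4]. *)

Require Import Defs.
From mathcomp Require Import all_boot all_order all_algebra.
From mathcomp Require Import complex.
From mathcomp Require Import reals exp trigo.
From mathcomp Require Import ring lra.

Import Order.TTheory GRing.Theory Num.Theory.
Local Open Scope ring_scope.

(** * The real-valued modulus on [R[i]] *)

Section ComplexModulus.
Local Open Scope complex_scope.
Local Notation N := Normc.normc.

Lemma normc_ge0 (R : rcfType) (z : R[i]) : 0 <= N z.
Proof. by case: z => a b; exact: sqrtr_ge0. Qed.

Lemma normc_conj (R : rcfType) (z : R[i]) : N z^* = N z.
Proof. by case: z => a b /=; rewrite sqrrN. Qed.

Lemma mul_conjc (R : rcfType) (z : R[i]) : z * z^* = (N z ^+ 2)%:C.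
Proof.
case: z => a b /=; rewrite sqr_sqrtr ?addr_ge0 ?sqr_ge0//.
by apply/eqP; rewrite eq_complex /=; apply/andP; split; apply/eqP; ring.
Qed.

Lemma normc_real (R : rcfType) (x : R) : N x%:C = `|x|.
Proof. by rewrite /= expr0n addr0 sqrtr_sqr. Qed.

Lemma normc_sum (R : rcfType) (I : finType) (P : pred I) (F : I -> R[i]) :
  N (\sum_(i | P i) F i) <= \sum_(i | P i) N (F i).
Proof.
elim/big_ind2: _ => [|x y z t xy zt|//]; first by rewrite Normc.normc0.
by rewrite (le_trans (le_normcD _ _)) ?lerD.
Qed.

End ComplexModulus.

(** * Finite Cauchy-Schwarz inequalities, real and complex *)

Section CauchySchwarz.
Local Notation N := Normc.normc.

Lemma cauchy_schwarz (R : realDomainType) (I : finType) (P : pred I) (u v : I -> R) :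
  (\sum_(i | P i) u i * v i) ^+ 2
    <= (\sum_(i | P i) u i ^+ 2) * (\sum_(i | P i) v i ^+ 2).
Proof.
set A := \sum_(i | P i) u i ^+ 2; set B := \sum_(i | P i) v i ^+ 2.
set S := \sum_(i | P i) u i * v i.
(* Lagrange's identity. *)
have E : \sum_(i | P i) \sum_(j | P j) (u i * v j - u j * v i) ^+ 2
       = (A * B - S ^+ 2) *+ 2.
  transitivity (\sum_(i | P i) (u i ^+ 2 * B + v i ^+ 2 * A - (u i * v i) * S *+ 2)).
    apply: eq_bigr => i _; rewrite !mulr_sumr -sumrMnl -sumrN -!big_split /=.
    by apply: eq_bigr => j _; ring.
  by rewrite !big_split /= sumrN sumrMnl -!mulr_suml -/A -/B -/S; ring.
have : 0 <= (A * B - S ^+ 2) *+ 2.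
  by rewrite -E; do 2 (apply: sumr_ge0 => ? _); exact: sqr_ge0.
by rewrite pmulrn_lge0// subr_ge0.
Qed.

(** Cauchy-Schwarz for the square roots of [u] and [v], since [s i] is at most
    [Num.sqrt (u i) * Num.sqrt (v i)]. This form suits the sum over the shift [h], where each term
    is only known through a bound on its square. *)
Lemma cauchy_schwarz_dominated (R : rcfType) (I : finType) (P : pred I)
    (s u v : I -> R) :
  (forall i, P i -> 0 <= s i) -> (forall i, P i -> 0 <= u i) ->
  (forall i, P i -> 0 <= v i) -> (forall i, P i -> s i ^+ 2 <= u i * v i) ->
  (\sum_(i | P i) s i) ^+ 2 <= (\sum_(i | P i) u i) * (\sum_(i | P i) v i).
Proof.
move=> s0 u0 v0 suv.
have -> : \sum_(i | P i) u i = \sum_(i | P i) Num.sqrt (u i) ^+ 2.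
  by apply: eq_bigr => i Pi; rewrite sqr_sqrtr ?u0.
have -> : \sum_(i | P i) v i = \sum_(i | P i) Num.sqrt (v i) ^+ 2.
  by apply: eq_bigr => i Pi; rewrite sqr_sqrtr ?v0.
apply: le_trans (cauchy_schwarz _ _ _ _ _).
have ss : \sum_(i | P i) s i <= \sum_(i | P i) Num.sqrt (u i) * Num.sqrt (v i).
  apply: ler_sum => i Pi; rewrite -sqrtrM ?u0// -[s i]ger0_norm ?s0//.
  by rewrite -sqrtr_sqr ler_wsqrtr ?suv.
by rewrite lerXn2r ?nnegrE// sumr_ge0// => i Pi; rewrite ?s0 ?mulr_ge0 ?sqrtr_ge0.
Qed.

Lemma cauchy_schwarz_normc (R : rcfType) (I : finType) (P : pred I) (u v : I -> R[i]) :
  N (\sum_(i | P i) u i * v i) ^+ 2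
    <= (\sum_(i | P i) N (u i) ^+ 2) * (\sum_(i | P i) N (v i) ^+ 2).
Proof.
apply: le_trans (cauchy_schwarz _ _ P (fun i => N (u i)) (fun i => N (v i))).
rewrite lerXn2r ?nnegrE ?normc_ge0 ?sumr_ge0//.
  by move=> i _; rewrite mulr_ge0 ?normc_ge0.
by apply: le_trans (normc_sum _ _ _ _) _; apply: ler_sum => i _; rewrite Normc.normcM.
Qed.

End CauchySchwarz.

(** * Additive characters of the prime field and their orthogonality *)

Section Characters.
Local Open Scope complex_scope.
Local Notation N := Normc.normc.

(** Any natural representative gives the same value, because a change of representative turns the
    angle by whole periods. Additivity of [e_p] then reduces to the addition formulas, with no
    reduction modulo [p]. *)
Lemma e_p_natr (R : realType) (p n : nat) : prime p ->
  e_p (n%:R : 'F_p) = cos (pi *+ 2 * n%:R / p%:R) +i* sin (pi *+ 2 * n%:R / p%:R) :> R[i].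
Proof.
move=> pp; have p0 : p%:R != 0 :> R by rewrite pnatr_eq0 -lt0n prime_gt0.
rewrite /e_p.
have -> : ((n%:R : 'F_p) : nat) = (n %% p)%N by rewrite val_Fp_nat.
have -> : pi *+ 2 * n%:R / p%:R = pi *+ 2 * (n %% p)%:R / p%:R + (pi *+ 2) *+ (n %/ p) :> R.
  by rewrite {1}(divn_eq n p) natrD natrM; field.
by rewrite !periodicn//; [exact: sinD2pi|exact: cosD2pi].
Qed.

Lemma e_pD (R : realType) (p : nat) (x y : 'F_p) : prime p ->
  e_p (x + y) = e_p x * e_p y :> R[i].
Proof.
move=> pp; rewrite -[x]natr_Zp -[y]natr_Zp -natrD !e_p_natr//.
rewrite natrD mulrDr mulrDl cosD sinD.
by apply/eqP; rewrite eq_complex /= eqxx /= addrC [_ * sin _]mulrC mulrC eqxx.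
Qed.

Lemma e_p0 (R : realType) (p : nat) : e_p (0 : 'F_p) = 1 :> R[i].
Proof. by rewrite /e_p /= mulr0 mul0r cos0 sin0. Qed.

Lemma e_p_mul_conj (R : realType) (p : nat) (x : 'F_p) : e_p x * (e_p x)^* = 1 :> R[i].
Proof. by rewrite mul_conjc /e_p /= cos2Dsin2 sqrtr1 expr1n. Qed.

Lemma e_pN (R : realType) (p : nat) (x : 'F_p) : prime p -> e_p (- x) = (e_p x)^* :> R[i].
Proof.
move=> pp; have := e_p_mul_conj R p x => E.
have: e_p x * e_p (- x) = e_p x * (e_p x)^* :> R[i] by rewrite E -e_pD// subrr e_p0.
(* The factor [e_p x] can be cancelled: were it zero, its product with its conjugate could not be
   1. *)
apply: mulfI; apply: contra_eq_neq E => ->; by rewrite mul0r eq_sym oner_neq0.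
Qed.

(** With the angle written as [2s], where [0 < s < pi], the equation [cos (2s) = 1] forces
    [cos s ^ 2 = 1], contradicting [sin s > 0]. *)
Lemma e_p_neq1 (R : realType) (p : nat) (x : 'F_p) : prime p -> x != 0 -> e_p x != 1 :> R[i].
Proof.
move=> pp x0; apply/negP; rewrite eq_complex /= => /andP[/eqP c1 _].
have p0 : 0 < p%:R :> R by rewrite ltr0n prime_gt0.
have xgt0 : (0 < (x : nat))%N by rewrite lt0n.
have xltp : ((x : nat) < p)%N by rewrite -[X in (_ < X)%N](Fp_cast pp) ltn_ord.
set s : R := pi * x%:R / p%:R.
have sE : pi *+ 2 * (x : nat)%:R / p%:R = s *+ 2 :> R by rewrite /s; ring.
have s_gt0 : 0 < s by rewrite /s divr_gt0// mulr_gt0 ?pi_gt0 ?ltr0n.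
have s_lt : s < pi by rewrite /s ltr_pdivrMr// ltr_pM2l ?pi_gt0// ltr_nat.
have : 0 < sin s by rewrite sin_gt0_pi// s_gt0.
move: c1; rewrite sE cos_mulr2n => c1.
have := cos2Dsin2 s => c2; move=> s0.
have := mulr_gt0 s0 s0; rewrite -expr2; nra.
Qed.

Lemma e_p_orthogonal (R : realType) (p : nat) (k : 'F_p) : prime p ->
  \sum_(x : 'F_p) e_p (k * x) = (if k == 0 then p%:R else 0) :> R[i].
Proof.
move=> pp; case: eqP => [->|/eqP k0].
  under eq_bigr do rewrite mul0r e_p0.
  by rewrite sumr_const card_Fp.
have ek : e_p k - 1 != 0 :> R[i] by rewrite subr_eq0 e_p_neq1.
apply: (mulfI ek); rewrite mulr0 mulrBl mul1r; apply/eqP; rewrite subr_eq0; apply/eqP.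
(* The sum is multiplied by [e_p k <> 1] under the shift [x -> x + 1]. *)
rewrite [RHS](reindex_inj (addIr 1)) mulr_sumr /=.
by apply: eq_bigr => x _; rewrite mulrDr mulr1 e_pD// mulrC.
Qed.
End Characters.

(** * Fourier inversion and Parseval *)

Section Fourier.
Local Open Scope complex_scope.
Local Notation N := Normc.normc.

(** The factor [1/p] sits on the physical side, so inversion and Parseval carry plain sums over
    frequencies. *)
Definition fourier {R : realType} {p : nat} (f : 'F_p -> R[i]) (k : 'F_p) : R[i] :=
  expect (fun x => f x * (e_p (k * x))^*).

Lemma fourier0 (R : realType) (p : nat) (f : 'F_p -> R[i]) : fourier f 0 = expect f.
Proof.
rewrite /fourier /expect; congr (_ * _).
by apply: eq_bigr => x _; rewrite mul0r e_p0 rmorph1 mulr1.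
Qed.

Lemma fourier_inversion (R : realType) (p : nat) (f : 'F_p -> R[i]) (x : 'F_p) :
  prime p -> f x = \sum_(k : 'F_p) fourier f k * e_p (k * x).
Proof.
move=> pp; have p0 : p%:R != 0 :> R[i] by rewrite pnatr_eq0 -lt0n prime_gt0.
(* Summing over the frequencies first leaves only [y = x], by orthogonality. *)
transitivity (p%:R^-1 * \sum_(y : 'F_p) f y * \sum_(k : 'F_p) e_p ((x - y) * k)).
  rewrite (bigD1 x) //= [X in _ + X]big1 ?addr0 => [|y yx].
    by rewrite subrr e_p_orthogonal// eqxx [f x * _]mulrC mulKf.
  by rewrite e_p_orthogonal// subr_eq0 eq_sym (negbTE yx) mulr0.
rewrite mulr_sumr; under eq_bigr do rewrite mulr_sumr mulr_sumr.
rewrite exchange_big /=; apply: eq_bigr => k _.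
rewrite /fourier /expect mulr_sumr mulr_suml; apply: eq_bigr => y _.
by rewrite mulrBl e_pD// e_pN// ![_ * k]mulrC; ring.
Qed.

Lemma norm2_sqr (R : realType) (p : nat) (f : 'F_p -> R[i]) :
  norm2 f ^+ 2 = p%:R^-1 * \sum_(x : 'F_p) N (f x) ^+ 2.
Proof. by rewrite sqr_sqrtr// mulr_ge0 ?invr_ge0// sumr_ge0// => x _; exact: sqr_ge0. Qed.

(** Stated for arbitrary coefficients because both pieces of the decomposed average arise directly
    as character series. Expanding the square and summing over [x] kills the off-diagonal pairs. *)
Lemma parseval_series (R : realType) (p : nat) (c : 'F_p -> R[i]) : prime p ->
  norm2 (fun x => \sum_(n : 'F_p) c n * e_p (n * x)) ^+ 2 = \sum_(n : 'F_p) N (c n) ^+ 2.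
Proof.
move=> pp; have p0 : p%:R != 0 :> R[i] by rewrite pnatr_eq0 -lt0n prime_gt0.
apply: (@complexI R); rewrite norm2_sqr rmorphM fmorphV rmorph_nat !rmorph_sum /=.
under [RHS]eq_bigr do rewrite -mul_conjc.
transitivity (p%:R^-1 * \sum_(n : 'F_p) \sum_(m : 'F_p)
    c n * (c m)^* * \sum_(x : 'F_p) e_p ((n - m) * x)).
  congr (_ * _); under eq_bigr do rewrite -mul_conjc.
  under [RHS]eq_bigr do (under eq_bigr do rewrite mulr_sumr).
  under [RHS]eq_bigr do rewrite exchange_big /=.
  rewrite [RHS]exchange_big /=; apply: eq_bigr => x _.
  rewrite mulr_suml; apply: eq_bigr => n _.
  rewrite rmorph_sum mulr_sumr; apply: eq_bigr => m _.
  by rewrite rmorphM mulrBl e_pD// e_pN// mulrACA mulrA.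
rewrite mulr_sumr; apply: eq_bigr => n _.
rewrite (bigD1 n) //= [X in _ + X]big1 ?addr0 => [|m mn].
  by rewrite subrr e_p_orthogonal// eqxx [c n * _ * _]mulrC mulKf.
by rewrite e_p_orthogonal// subr_eq0 eq_sym (negbTE mn) mulr0.
Qed.

Lemma parseval (R : realType) (p : nat) (f : 'F_p -> R[i]) : prime p ->
  norm2 f ^+ 2 = \sum_(k : 'F_p) N (fourier f k) ^+ 2.
Proof.
move=> pp; rewrite -parseval_series// !norm2_sqr; congr (_ * _).
by apply: eq_bigr => x _; rewrite {1}(@fourier_inversion _ _ f x pp).
Qed.

Lemma norm2D_sqr (R : realType) (p : nat) (f g : 'F_p -> R[i]) :
  norm2 (fun x => f x + g x) ^+ 2 <= (norm2 f ^+ 2 + norm2 g ^+ 2) *+ 2.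
Proof.
rewrite !norm2_sqr -mulrDr -big_split /= -mulrnAr -sumrMnl ler_wpM2l ?invr_ge0//.
apply: ler_sum => x _; have := le_normcD (f x) (g x).
have := normc_ge0 _ (f x + g x); have := sqr_ge0 (N (f x) - N (g x)).
by move: (N (f x + g x)) (N (f x)) (N (g x)) => s u v; nra.
Qed.

End Fourier.

(** * The bilinear form with kernel [K] on a finite abelian group *)

Section BilinearForm.
Local Open Scope complex_scope.
Local Notation N := Normc.normc.

(* AM-GM on [w y * w y'], then count along rows and columns of [D]. *)
Lemma schur_sparse (R : realFieldType) (T : finType) (D : {set T * T}) (w : T -> R) (M : R) :
  (forall y, #|[set y' | (y, y') \in D]|%:R <= M) ->
  (forall y', #|[set y | (y, y') \in D]|%:R <= M) ->
  \sum_y \sum_y' w y * w y' * ((y, y') \in D)%:R <= M * \sum_y w y ^+ 2.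
Proof.
move=> rowD colD.
have row y : \sum_y' w y ^+ 2 * ((y, y') \in D)%:R <= M * w y ^+ 2.
  by rewrite -mulr_sumr mulrC -natr_sum -big_mkcond sum1dep_card ler_wpM2r ?sqr_ge0.
have col y' : \sum_y w y' ^+ 2 * ((y, y') \in D)%:R <= M * w y' ^+ 2.
  by rewrite -mulr_sumr mulrC -natr_sum -big_mkcond sum1dep_card ler_wpM2r ?sqr_ge0.
have rows := ler_sum (index_enum T) (fun y (_ : xpredT y) => row y).
have := ler_sum (index_enum T) (fun y (_ : xpredT y) => col y); rewrite exchange_big /= => cols.
suff : (\sum_y \sum_y' w y * w y' * ((y, y') \in D)%:R) *+ 2
    <= \sum_y \sum_y' w y ^+ 2 * ((y, y') \in D)%:R
       + \sum_y \sum_y' w y' ^+ 2 * ((y, y') \in D)%:R.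
  rewrite -!mulr_sumr in rows cols; lra.
rewrite -big_split -sumrMnl; apply: ler_sum => y _.
rewrite -big_split -sumrMnl; apply: ler_sum => y' _ /=.
rewrite -mulrDl -mulrnAl ler_wpM2r//.
by have := sqr_ge0 (w y - w y'); nra.
Qed.

Lemma sum_normc_sqr_sum (R : rcfType) (T : finType) (B : T -> R[i]) (k : T -> T -> R[i]) :
  (\sum_x N (\sum_y B y * k x y) ^+ 2)%:C
  = \sum_y \sum_y' B y * (B y')^* * \sum_x k x y * (k x y')^*.
Proof.
rewrite rmorph_sum /=; under eq_bigr do rewrite -mul_conjc.
under [RHS]eq_bigr do (under eq_bigr do rewrite mulr_sumr).
under [RHS]eq_bigr do rewrite exchange_big /=.
rewrite [RHS]exchange_big /=; apply: eq_bigr => x _.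
rewrite mulr_suml; apply: eq_bigr => y _.
rewrite rmorph_sum mulr_sumr; apply: eq_bigr => y' _.
by rewrite rmorphM /=; ring.
Qed.

(** Cauchy-Schwarz in [x] removes [u]; expanding the remaining square yields the Gram matrix of the
    columns of [k]. Its entries are at most [d] off [D], and on the sparse set [D] at most the
    trivial [#|T| c^2]. *)
Lemma almost_orthogonal_bound (R : rcfType) (T : finType) (u B : T -> R[i])
    (k : T -> T -> R[i]) (D : {set T * T}) (c d M : R) :
  0 <= c -> 0 <= d ->
  (forall x y, N (k x y) <= c) ->
  (forall y, #|[set y' | (y, y') \in D]|%:R <= M) ->
  (forall y', #|[set y | (y, y') \in D]|%:R <= M) ->
  (forall y y', (y, y') \notin D -> N (\sum_x k x y * (k x y')^*) <= d) ->
  N (\sum_x \sum_y u x * B y * k x y) ^+ 2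
    <= (\sum_x N (u x) ^+ 2)
       * (#|T|%:R * c ^+ 2 * M * (\sum_y N (B y) ^+ 2) + d * (\sum_y N (B y)) ^+ 2).
Proof.
move=> c0 d0 kc rowD colD offD.
have -> : \sum_x \sum_y u x * B y * k x y = \sum_x u x * (\sum_y B y * k x y).
  by apply: eq_bigr => x _; rewrite mulr_sumr; apply: eq_bigr => y _; rewrite mulrA.
apply: le_trans (cauchy_schwarz_normc _ _ _ _ _) _.
rewrite ler_wpM2l ?sumr_ge0// => [x _|]; first exact: sqr_ge0.
have S0 : 0 <= \sum_x N (\sum_y B y * k x y) ^+ 2.
  by rewrite sumr_ge0// => x _; exact: sqr_ge0.
(* A nonnegative real is the modulus of its complex embedding, so the complex expansion can be
   bounded term by term. *)
rewrite -[leLHS]ger0_norm// -normc_real sum_normc_sqr_sum.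
(* Since [d] is nonnegative it may be added on [D] as well; the sum then splits into a sparse part
   and a full product. *)
have Jbound y y' : N (\sum_x k x y * (k x y')^*)
    <= #|T|%:R * c ^+ 2 * ((y, y') \in D)%:R + d.
  have cT : 0 <= #|T|%:R * c ^+ 2 by rewrite mulr_ge0 ?sqr_ge0.
  case: (boolP ((y, y') \in D)) => [_|/offD]; last by rewrite mulr0 add0r.
  rewrite mulr1; suff: N (\sum_x k x y * (k x y')^*) <= #|T|%:R * c ^+ 2 by lra.
  apply: le_trans (normc_sum _ _ _ _) _.
  rewrite mulr_natl -sumr_const; apply: ler_sum => x _.
  by rewrite Normc.normcM normc_conj expr2 ler_pM ?normc_ge0.
apply: (@le_trans _ _ (\sum_y \sum_y' (#|T|%:R * c ^+ 2
    * (N (B y) * N (B y') * ((y, y') \in D)%:R) + d * (N (B y) * N (B y'))))).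
  apply: le_trans (normc_sum _ _ _ _) _; apply: ler_sum => y _.
  apply: le_trans (normc_sum _ _ _ _) _; apply: ler_sum => y' _.
  rewrite !Normc.normcM normc_conj.
  have := Jbound y y'; have := normc_ge0 _ (B y); have := normc_ge0 _ (B y').
  move: (N (B y)) (N (B y')) => s t t0 s0 /(ler_wpM2l (mulr_ge0 s0 t0)).
  by move/le_trans; apply; rewrite le_eqVlt; apply/orP; left; apply/eqP; ring.
under eq_bigr do rewrite big_split -!mulr_sumr /=.
rewrite big_split /= -!mulr_sumr -!mulr_suml -expr2 lerD2r.
rewrite -[leRHS]mulrA ler_wpM2l ?mulr_ge0 ?sqr_ge0//.
exact: schur_sparse.
Qed.

Lemma bilinear_form_expansion (R : rcfType) (G : finZmodType) (a b : G -> R[i])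
    (K : G -> G -> R[i]) :
  (\sum_n N (\sum_x a x * b (n - x) * K x (n - x)) ^+ 2)%:C
  = \sum_h \sum_x \sum_y (a x * (a (x - h))^*) * (b y * (b (y + h))^*)
                         * (K x y * (K (x - h) (y + h))^*).
Proof.
transitivity (\sum_n \sum_x \sum_h (a x * (a (x - h))^*)
    * (b (n - x) * (b (n - x + h))^*) * (K x (n - x) * (K (x - h) (n - x + h))^*)).
  rewrite rmorph_sum /=; apply: eq_bigr => n _; rewrite -mul_conjc mulr_suml.
  apply: eq_bigr => x _; rewrite rmorph_sum mulr_sumr.
  (* The second frequency in the expanded square is written [x - h]. *)
  rewrite (reindex_inj (inj_comp (addrI x) oppr_inj)) /=; apply: eq_bigr => h _.
  have -> : n - x + h = n - (x - h) by rewrite opprB addrA addrAC.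
  by rewrite !rmorphM /=; ring.
under eq_bigr do rewrite exchange_big /=.
rewrite exchange_big /=; apply: eq_bigr => h _; rewrite exchange_big /=.
apply: eq_bigr => x _; rewrite (reindex_inj (addIr x)) /=.
by apply: eq_bigr => y _; rewrite addrK.
Qed.

Lemma bilinear_form_bound (R : rcfType) (G : finZmodType) (a b : G -> R[i])
    (K : G -> G -> R[i]) (c d M : R) :
  0 <= c -> 0 <= d -> 0 <= M ->
  (forall x y, N (K x y) <= c) ->
  (forall h, h != 0 -> exists D : {set G * G},
     [/\ forall y, #|[set y' | (y, y') \in D]|%:R <= M,
         forall y', #|[set y | (y, y') \in D]|%:R <= M
       & forall y y', (y, y') \notin D ->
           N (\sum_x K x y * (K (x - h) (y + h))^*
                     * (K x y')^* * K (x - h) (y' + h)) <= d]) ->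
  \sum_n N (\sum_x a x * b (n - x) * K x (n - x)) ^+ 2
    <= (c ^+ 2 + Num.sqrt (#|G|%:R * (M * c ^+ 4 + d)))
       * (\sum_x N (a x) ^+ 2) * (\sum_y N (b y) ^+ 2).
Proof.
move=> c0 d0 M0 Kc KD.
set A := \sum_x N (a x) ^+ 2; set B := \sum_y N (b y) ^+ 2.
have A0 : 0 <= A by rewrite sumr_ge0// => x _; exact: sqr_ge0.
have B0 : 0 <= B by rewrite sumr_ge0// => x _; exact: sqr_ge0.
pose S h := \sum_x \sum_y (a x * (a (x - h))^*) * (b y * (b (y + h))^*)
                         * (K x y * (K (x - h) (y + h))^*).
pose al h := \sum_x N (a x * (a (x - h))^*) ^+ 2.
pose be h := \sum_y N (b y * (b (y + h))^*) ^+ 2.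
pose be1 h := (\sum_y N (b y * (b (y + h))^*)) ^+ 2.
(* The second factor of [almost_orthogonal_bound], with [c ^+ 2] in the role of [c] because the
   kernel for a fixed shift is a product of two values of [K]. *)
pose bt h := #|G|%:R * (c ^+ 2) ^+ 2 * M * be h + d * be1 h.
have al0 h : 0 <= al h by rewrite sumr_ge0// => x _; exact: sqr_ge0.
have be0 h : 0 <= be h by rewrite sumr_ge0// => x _; exact: sqr_ge0.
have bt0 h : 0 <= bt h by rewrite addr_ge0 ?mulr_ge0 ?exprn_ge0 ?be0 ?sumr_ge0// => y _; exact: normc_ge0.
have KKc h x y : N (K x y * (K (x - h) (y + h))^*) <= c ^+ 2.
  by rewrite Normc.normcM normc_conj expr2 ler_pM ?normc_ge0.
(* Summed over all shifts, [x - h] runs through the group independently of [x], so the double sum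
   factors. *)
have sum_al : \sum_h al h = A ^+ 2.
  rewrite /al exchange_big /= expr2 {1}/A mulr_suml; apply: eq_bigr => x _.
  rewrite /A mulr_sumr [RHS](reindex_inj (inj_comp (addrI x) oppr_inj)) /=.
  by apply: eq_bigr => h _; rewrite Normc.normcM normc_conj exprMn.
have sum_be : \sum_h be h = B ^+ 2.
  rewrite /be exchange_big /= expr2 {1}/B mulr_suml; apply: eq_bigr => y _.
  rewrite /B mulr_sumr [RHS](reindex_inj (addrI y)) /=.
  by apply: eq_bigr => h _; rewrite Normc.normcM normc_conj exprMn.
(* This bound is uniform in [h], by Cauchy-Schwarz and translation invariance; summing it over [h]
   costs the factor [#|G|] in front of [d]. *)
have be1B h : be1 h <= B ^+ 2.
  rewrite /be1; under eq_bigr do rewrite Normc.normcM normc_conj.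
  apply: le_trans (cauchy_schwarz _ _ _ _ _) _; rewrite expr2 /B.
  by rewrite [X in _ <= _ * X](reindex_inj (addIr h)).
have S0 : N (S 0) <= c ^+ 2 * A * B.
  apply: le_trans (normc_sum _ _ _ _) _; rewrite mulrAC mulrC mulr_suml.
  apply: ler_sum => x _; rewrite !mulr_sumr.
  apply: le_trans (normc_sum _ _ _ _) _; apply: ler_sum => y _.
  rewrite Normc.normcM subr0 addr0 !mul_conjc; have := KKc 0 x y; rewrite subr0 addr0 !mul_conjc.
  have n0 := mulr_ge0 (sqr_ge0 (N (a x))) (sqr_ge0 (N (b y))).
  rewrite -rmorphM !normc_real !ger0_norm ?sqr_ge0// => /(ler_wpM2l n0)/le_trans; apply.
  by rewrite -mulrA [N (b y) ^+ 2 * _]mulrC.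
have Sh h : h != 0 -> N (S h) ^+ 2 <= al h * bt h.
  move=> /KD[D [rowD colD offD]].
  apply: (almost_orthogonal_bound _ _ _ _ _ D) => //; first exact: sqr_ge0.
  move=> y y' /offD; apply: le_trans; rewrite le_eqVlt; apply/orP; left.
  apply/eqP; congr (N _); apply: eq_bigr => x _.
  (* Conjugating the kernel at [y'] undoes one conjugation, which gives exactly the correlation in
     the hypothesis. *)
  by rewrite rmorphM [X in _ * (_ * X) = _]conjcK !mulrA.
have sumS : \sum_(h | h != 0) N (S h)
    <= Num.sqrt (#|G|%:R * (M * c ^+ 4 + d)) * A * B.
  have GM : 0 <= #|G|%:R * (M * c ^+ 4 + d).
    by rewrite mulr_ge0 ?addr_ge0 ?mulr_ge0 ?exprn_ge0.
  have L0 : 0 <= \sum_(h | h != 0) N (S h) by rewrite sumr_ge0// => h _; exact: normc_ge0.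
  have R0 := mulr_ge0 (mulr_ge0 (sqrtr_ge0 (#|G|%:R * (M * c ^+ 4 + d))) A0) B0.
  rewrite -(@ler_pXn2r _ 2)//.
  have := @cauchy_schwarz_dominated _ _ _ (fun h => N (S h)) al bt
    (fun h _ => normc_ge0 _ _) (fun h _ => al0 h) (fun h _ => bt0 h) Sh.
  move/le_trans; apply; rewrite !exprMn sqr_sqrtr//.
  have le_al : \sum_(h | h != 0) al h <= A ^+ 2.
    by rewrite -sum_al [leRHS](bigD1 0) //= lerDr.
  have le_bt : \sum_(h | h != 0) bt h <= #|G|%:R * (M * c ^+ 4 + d) * B ^+ 2.
    apply: (@le_trans _ _ (\sum_h bt h)).
      by rewrite [leRHS](bigD1 0) //= lerDr.
    rewrite big_split /= -!mulr_sumr sum_be.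
    have : \sum_h be1 h <= #|G|%:R * B ^+ 2.
      by rewrite mulr_natl -sumr_const; apply: ler_sum.
    move/(ler_wpM2l d0); rewrite -exprM => le_be1.
    by move: le_be1; set X := d * _; set Y := B ^+ 2; nra.
  apply: le_trans (ler_pM _ _ le_al le_bt) _; rewrite ?sumr_ge0//.
  by rewrite mulrA [X in X * _]mulrC.
have T0 : 0 <= \sum_n N (\sum_x a x * b (n - x) * K x (n - x)) ^+ 2.
  by rewrite sumr_ge0// => x _; exact: sqr_ge0.
rewrite -[leLHS]ger0_norm// -normc_real bilinear_form_expansion.
apply: le_trans (normc_sum _ _ _ _) _; rewrite (bigD1 0) //= !mulrDl.
by rewrite lerD.
Qed.

End BilinearForm.

(** * Frequency decomposition of the bilinear average *)

Section FourierDecomposition.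
Local Open Scope complex_scope.
Local Notation N := Normc.normc.

Lemma bilinear_avg_fourier (R : realType) (p : nat) (phi1 phi2 : 'F_p -> 'F_p)
    (f1 f2 : 'F_p -> R[i]) (x : 'F_p) : prime p ->
  bilinear_avg phi1 phi2 f1 f2 x - expect f1 * expect f2
  = \sum_(k : 'F_p) (if k == 0 then 0 else
        fourier f1 k * expect f2 * (p%:R^-1 * \sum_(z : 'F_p) e_p (k * phi1 z)))
      * e_p (k * x)
    + \sum_(n : 'F_p) (\sum_(k : 'F_p) fourier f1 k * fourier f2 (n - k)
        * kernelK phi1 phi2 k (n - k)) * e_p (n * x).
Proof.
move=> pp; have p0 : p%:R != 0 :> R[i] by rewrite pnatr_eq0 -lt0n prime_gt0.
pose m (k l : 'F_p) : R[i] := p%:R^-1 * \sum_(z : 'F_p) e_p (k * phi1 z + l * phi2 z).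
(* The kernel is set to 0 on [l = 0], so the multiplier [m] is [K] plus its column [l = 0]; that
   column yields the main term and the linear term. *)
have mE k l : m k l = kernelK phi1 phi2 k l + (if l == 0 then m k 0 else 0).
  by rewrite /kernelK -/(m k l); case: eqP => [->|_]; rewrite ?add0r ?addr0.
have m0 k : m k 0 = p%:R^-1 * \sum_(z : 'F_p) e_p (k * phi1 z).
  by congr (_ * _); apply: eq_bigr => z _; rewrite mul0r addr0.
have m00 : m 0 0 = 1.
  rewrite m0; under eq_bigr do rewrite mul0r e_p0.
  by rewrite sumr_const card_Fp// mulVf.
have avgE : bilinear_avg phi1 phi2 f1 f2 x =
    \sum_(k : 'F_p) \sum_(l : 'F_p) fourier f1 k * fourier f2 l * m k l * e_p ((k + l) * x).
  rewrite /bilinear_avg mulr_sumr.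
  under [RHS]eq_bigr do under eq_bigr do rewrite /m mulrA mulr_sumr mulr_suml.
  under [RHS]eq_bigr do rewrite exchange_big /=.
  rewrite [RHS]exchange_big /=; apply: eq_bigr => z _.
  rewrite (@fourier_inversion _ _ f1 _ pp) (@fourier_inversion _ _ f2 _ pp).
  rewrite mulr_suml mulr_sumr; apply: eq_bigr => k _.
  rewrite !mulr_sumr; apply: eq_bigr => l _.
  by rewrite !mulrDr mulrDl !e_pD//; ring.
have secondE : \sum_(n : 'F_p) (\sum_(k : 'F_p) fourier f1 k * fourier f2 (n - k)
        * kernelK phi1 phi2 k (n - k)) * e_p (n * x) =
    \sum_(k : 'F_p) \sum_(l : 'F_p) fourier f1 k * fourier f2 l
      * kernelK phi1 phi2 k l * e_p ((k + l) * x).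
  under eq_bigr do rewrite mulr_suml.
  rewrite exchange_big /=; apply: eq_bigr => k _.
  rewrite (reindex_inj (addrI k)) /=; apply: eq_bigr => l _.
  by rewrite [k + l - k]addrC addKr.
rewrite secondE avgE addrC.
under eq_bigr do (under eq_bigr do rewrite mE mulrDr mulrDl).
under eq_bigr do rewrite big_split /=.
rewrite big_split /= addrCA addrC; congr (_ + _).
have zeroE k : \sum_(l : 'F_p) fourier f1 k * fourier f2 l * (if l == 0 then m k 0 else 0)
    * e_p ((k + l) * x) = fourier f1 k * expect f2 * m k 0 * e_p (k * x).
  rewrite (bigD1 0) // eqxx [X in _ + X = _]big1 ?addr0 ?fourier0// => l l0.
  by rewrite (negbTE l0) mulr0 mul0r.
under eq_bigr do rewrite zeroE.
(* The frequency [k = 0] of that column is [expect f1 * expect f2], which cancels the subtracted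
   product. *)
rewrite (bigD1 0) //= [in RHS](bigD1 0) //= !mul0r e_p0 m00 fourier0 !mulr1.
rewrite addKr add0r; apply: eq_bigr => k k0.
by rewrite (negbTE k0) m0.
Qed.

Lemma linear_term_bound (R : realType) (p : nat) (f1 f2 : 'F_p -> R[i])
    (w : 'F_p -> R[i]) (e : R) : prime p -> 0 <= e ->
  (forall k, k != 0 -> N (w k) <= e) ->
  norm2 (fun x => \sum_(k : 'F_p) (if k == 0 then 0 else
        fourier f1 k * expect f2 * w k) * e_p (k * x)) ^+ 2
    <= e ^+ 2 * norm2 f1 ^+ 2 * norm2 f2 ^+ 2.
Proof.
move=> pp e0 we; rewrite parseval_series//.
(* The mean is the zeroth Fourier coefficient, hence a single term of Parseval's sum. *)
have E2 : N (expect f2) ^+ 2 <= norm2 f2 ^+ 2.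
  rewrite parseval// (bigD1 0) //= fourier0 lerDl sumr_ge0// => k _; exact: sqr_ge0.
rewrite [norm2 f1 ^+ 2]parseval// mulr_sumr mulr_suml; apply: ler_sum => k _.
case: eqP => [_|/eqP k0].
  by rewrite Normc.normc0 expr0n; apply: mulr_ge0; [apply: mulr_ge0|]; exact: sqr_ge0.
have w2 : N (w k) ^+ 2 <= e ^+ 2 by rewrite lerXn2r ?nnegrE ?normc_ge0 ?we.
rewrite (Normc.normcM (_ * _)) (Normc.normcM (fourier _ _)) !exprMn mulrC mulrA.
apply: le_trans (ler_wpM2l _ E2); last by apply: mulr_ge0; exact: sqr_ge0.
by do 2 (apply: ler_wpM2r; first exact: sqr_ge0).
Qed.

End FourierDecomposition.

(** * Choice of the constant and comparison of the exponents *)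

Theorem theorem1p1 (R : realType) (C1 C2 C3 M : R)
    (hC1 : 0 < C1) (hC2 : 0 < C2) (hC3 : 0 < C3) (hM : 0 < M) :
  exists C : R,
  forall (p : nat) (phi1 phi2 : 'F_p -> 'F_p) (theta alpha beta : R),
    prime p ->
    0 < theta -> theta <= 1 ->
    4%:R^-1 < alpha -> alpha < 1 ->
    1 < beta ->
    (forall s : 'F_p, s != 0 ->
       Normc.normc (p%:R^-1 * \sum_(y : 'F_p) e_p (s * phi1 y) : R[i])
         <= C1 * p%:R `^ (- theta)) ->
    (forall x y : 'F_p,
       Normc.normc (kernelK phi1 phi2 x y : R[i]) <= C2 * p%:R `^ (- alpha)) ->
    (forall h : 'F_p, h != 0 ->
       exists D : {set 'F_p * 'F_p},
         [/\ forall y : 'F_p, #|[set y' | (y, y') \in D]|%:R <= M,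
             forall y' : 'F_p, #|[set y | (y, y') \in D]|%:R <= M
           & forall y y' : 'F_p, (y, y') \notin D ->
               Normc.normc (corrI phi1 phi2 h y y' : R[i])
                 <= C3 * p%:R `^ (- beta)]) ->
    let gamma :=
      Num.min theta
        (Num.min (alpha - 4%:R^-1) (beta / 4%:R - 4%:R^-1)) in
    forall f1 f2 : 'F_p -> R[i],
      norm2 (fun x => bilinear_avg phi1 phi2 f1 f2 x - expect f1 * expect f2)
        <= C * p%:R `^ (- gamma) * norm2 f1 * norm2 f2.
Proof.
(* The factor 2 comes from [norm2D_sqr], used in place of Minkowski. *)
pose C0 := (C1 ^+ 2 + (C2 ^+ 2 + Num.sqrt (M * C2 ^+ 4 + C3))) *+ 2.
exists (Num.sqrt C0) => p phi1 phi2 theta alpha beta pp _ _ al4 al1 be1 hphi hK hI gamma f1 f2.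
have C00 : 0 <= C0 by rewrite mulrn_wge0// !addr_ge0 ?sqr_ge0 ?sqrtr_ge0.
have p1 : 1 <= p%:R :> R by rewrite ler1n prime_gt0.
have p_gt0 : 0 < p%:R :> R by apply: lt_le_trans p1.
have gam : [/\ gamma <= theta, gamma <= alpha - 4%:R^-1 & gamma <= beta / 4%:R - 4%:R^-1].
  by rewrite /gamma !ge_min !lexx !orbT.
case: gam => gth gal gbe.
set q := p%:R `^ (- gamma).
have q0 : 0 <= q by exact: powR_ge0.
have powX (r : R) n : (p%:R `^ r) ^+ n = p%:R `^ (r * n%:R) by rewrite -powR_mulrn ?powR_ge0// -powRrM.
have pM r : p%:R * p%:R `^ r = p%:R `^ (1 + r) :> R.
  by rewrite powRD ?powRr1 ?ler0n// (gt_eqF p_gt0) implybT.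
have norm_ge0 f : 0 <= norm2 f :> R by exact: sqrtr_ge0.
rewrite -(@ler_pXn2r _ 2) ?nnegrE ?mulr_ge0 ?sqrtr_ge0 ?norm_ge0//.
rewrite !exprMn [Num.sqrt C0 ^+ 2]sqr_sqrtr//.
rewrite [norm2 (fun x => bilinear_avg _ _ _ _ x - _)](_ : _ =
  norm2 (fun x => \sum_(k : 'F_p) (if k == 0 then 0 else
        fourier f1 k * expect f2 * (p%:R^-1 * \sum_(z : 'F_p) e_p (k * phi1 z)))
      * e_p (k * x)
    + \sum_(n : 'F_p) (\sum_(k : 'F_p) fourier f1 k * fourier f2 (n - k)
        * kernelK phi1 phi2 k (n - k)) * e_p (n * x))); last first.
  by congr (Num.sqrt (_ * _)); apply: eq_bigr => x _; rewrite bilinear_avg_fourier.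
apply: le_trans (norm2D_sqr _ _ _ _) _.
have lin := linear_term_bound R p f1 f2 _ _ pp (mulr_ge0 (ltW hC1) (powR_ge0 _ _)) hphi.
have bil := bilinear_form_bound R 'F_p (fourier f1) (fourier f2) (kernelK phi1 phi2) _ _ _
  (mulr_ge0 (ltW hC2) (powR_ge0 _ _)) (mulr_ge0 (ltW hC3) (powR_ge0 _ _)) (ltW hM) hK hI.
rewrite -!parseval// card_Fp// in bil.
have coef1 : (C1 * p%:R `^ (- theta)) ^+ 2 <= C1 ^+ 2 * q ^+ 2.
  by rewrite exprMn ler_wpM2l ?sqr_ge0// lerXn2r ?nnegrE ?powR_ge0// ler_powR ?lerN2.
have coef2 : (C2 * p%:R `^ (- alpha)) ^+ 2 <= C2 ^+ 2 * q ^+ 2.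
  by rewrite exprMn ler_wpM2l ?sqr_ge0// lerXn2r ?nnegrE ?powR_ge0// ler_powR//; lra.
(* Origin of the shifts by [1/4] in [gamma]: the sum over [h] costs one factor [p] under a square
   root, and [1 - 4 alpha] and [1 - beta] are both at most [-4 gamma]. *)
have pal : p%:R * p%:R `^ (- alpha) ^+ 4 <= q ^+ 4.
  by rewrite !powX pM ler_powR//; lra.
have pbe : p%:R * p%:R `^ (- beta) <= q ^+ 4.
  by rewrite powX pM ler_powR//; lra.
(* The common factor [q ^+ 4] leaves the root as [q ^+ 2], the same order as the other two
   coefficients. *)
have coef3 : Num.sqrt (p%:R * (M * (C2 * p%:R `^ (- alpha)) ^+ 4 + C3 * p%:R `^ (- beta)))
    <= Num.sqrt (M * C2 ^+ 4 + C3) * q ^+ 2.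
  have MC0 : 0 <= M * C2 ^+ 4 by rewrite mulr_ge0 ?exprn_ge0// ltW.
  rewrite -[q ^+ 2]ger0_norm ?sqr_ge0// -sqrtr_sqr -sqrtrM ?addr_ge0 ?(ltW hC3)//.
  apply: ler_wsqrtr; rewrite -exprM mulrDr exprMn mulrDl lerD//.
    by have := ler_wpM2l MC0 pal; apply: le_trans; rewrite le_eqVlt; apply/orP; left; apply/eqP; ring.
  by rewrite mulrCA ler_wpM2l ?(ltW hC3).
apply: (@le_trans _ _ ((C1 ^+ 2 * q ^+ 2 * norm2 f1 ^+ 2 * norm2 f2 ^+ 2
  + (C2 ^+ 2 * q ^+ 2 + Num.sqrt (M * C2 ^+ 4 + C3) * q ^+ 2)
    * norm2 f1 ^+ 2 * norm2 f2 ^+ 2) *+ 2)); last first.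
  by rewrite le_eqVlt; apply/orP; left; apply/eqP; rewrite /C0; ring.
rewrite lerMn2r; apply: lerD.
  by apply: le_trans lin _; do 2 (apply: ler_wpM2r; first exact: sqr_ge0).
rewrite parseval_series//; apply: le_trans bil _.
by do 2 (apply: ler_wpM2r; first exact: sqr_ge0); exact: lerD.
Qed.
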